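(* Let $D$ be a convex disc in the Euclidean plane that is not a circular disc. Then there exist finitely many pairwise disjoint similar copies of $D$ in the plane which cannot be separated by a polygonal tiling, i.e. for which no separating polygonal tiling of the plane exists.
   Context: A convex disc is a compact convex subset of the Euclidean plane with nonempty interior. A similar copy of $D$ is the image of $D$ under a similarity of the plane. Convex polygons are understood in an extended sense: closed convex regions with nonempty interior bounded by a finite number of segments, half lines or lines; they may be unbounded (e.g. half planes, strips, angular sectors), and the whole plane is allowed. A partition (tiling) of the plane into cells is a family of cells that cover the plane and have pairwise disjoint interiors. A separating polygonal tiling for a family of pairwise disjoint convex discs is a tiling of the plane by convex polygons (in the extended sense) such that each cell contains exactly one disc of the family and every disc of the family is contained in some cell. *)

(* Defs.v *)
From HB Require Import structures.
From mathcomp Require Import all_boot all_order all_algebra.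
From mathcomp Require Import all_classical all_reals all_analysis.

Set Implicit Arguments.
Unset Strict Implicit.
Unset Printing Implicit Defensive.

Import Order.TTheory GRing.Theory Num.Theory.
Import numFieldNormedType.Exports.

Local Open Scope classical_set_scope.
Local Open Scope ring_scope.

Notation plane R := 'rV[R]_2.

(* The library norm on 'rV[R]_2 is the max norm, so the Euclidean distance is
   defined explicitly. The max norm is used only through its topology
   (compact, closed, interior, closure), which is the Euclidean one. *)
Definition edist (R : realType) (x y : plane R) : R :=
  Num.sqrt (\sum_(i < 2) (x ord0 i - y ord0 i) ^+ 2).

Definition convex_disc (R : realType) (D : set (plane R)) : Prop :=
  [/\ compact D, @convex_set R (plane R) D & interior D !=set0].

Definition circular_disc (R : realType) (D : set (plane R)) : Prop :=
  exists (c : plane R) (r : R), 0 < r /\ D = [set x | edist x c <= r].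

(* Orientation-reversing similarities are included. *)
Definition similarity (R : realType) (f : plane R -> plane R) : Prop :=
  exists2 k : R, 0 < k & forall x y, edist (f x) (f y) = k * edist x y.

Definition similar_copy (R : realType) (D C : set (plane R)) : Prop :=
  exists2 f : plane R -> plane R, similarity f & C = f @` D.

Definition segment (R : realType) (a b : plane R) : set (plane R) :=
  [set a + t *: (b - a) | t in `[0, 1]].

Definition half_line (R : realType) (a b : plane R) : set (plane R) :=
  [set a + t *: (b - a) | t in `[0, +oo[].

Definition line (R : realType) (a b : plane R) : set (plane R) :=
  [set a + t *: (b - a) | t in [set: R]].

Definition straight_piece (R : realType) (S : set (plane R)) : Prop :=
  exists a b : plane R,
    a != b /\ [\/ S = segment a b, S = half_line a b | S = line a b].

Definition boundary (R : realType) (P : set (plane R)) : set (plane R) :=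
  closure P `\` interior P.

(* The set E of boundary pieces may be empty, which gives the whole plane. *)
Definition convex_polygon (R : realType) (P : set (plane R)) : Prop :=
  [/\ closed P, @convex_set R (plane R) P, interior P !=set0 &
      exists E : set (set (plane R)),
        [/\ finite_set E, E `<=` @straight_piece R &
            boundary P = \bigcup_(S in E) S]].

(* Cells have nonempty interior below, so a family of cells with pairwise
   disjoint interiors has no repetition and is given by its set of members;
   likewise for families of pairwise disjoint nonempty discs. *)
Definition tiling (R : realType) (T : set (set (plane R))) : Prop :=
  cover T id = [set: plane R] /\ trivIset T (@interior (plane R)).

Definition separating_polygonal_tiling (R : realType)
    (F T : set (set (plane R))) : Prop :=
  [/\ tiling T,
      T `<=` @convex_polygon R,
      (forall P, T P -> exists! C, F C /\ C `<=` P) &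
      (forall C, F C -> exists2 P, T P & C `<=` P)].

(* Main.v *)
(* From a viewpoint x, say that C occludes C' if a segment from x to an inner
   point of C' passes through an inner point of C. A convex cell containing x
   and C' then meets the interior of C, so if every member of a family is
   occluded by another one, x lies in no cell. Among circular discs occlusion
   from x is acyclic, since it decreases the power of x; for D not circular a
   cycle is built as follows.

   If any two tangent lines at exposed points of D had equal tangent segments,
   all exposed points would lie on a common circle and D would be circular
   (equal tangents mean that e1 - e2 is parallel to u1 - u2, where e_i are the
   exposed points and u_i the outer unit normals). So there is a point x whose
   two tangent segments to D have distinct lengths T1 < T2, and the sector of
   radii T1 < r < T2 outside the visual angle of D misses D. In this sector one
   runs a chain of tiny copies of D along a logarithmic spiral around x, from
   just in front of the far contact point to just behind the near one, each
   copy placed in front of the end of the previous one. A copy whose diameter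
   is orthogonal to the line of sight lies in two discs centred at the ends of
   that diameter, so a relative drop of order (step angle)^2 per copy keeps the
   copies disjoint, and the total drop tends to 0 with the step. *)

Require Import Defs.
From HB Require Import structures.
From mathcomp Require Import all_boot all_order all_algebra.
From mathcomp Require Import all_classical all_reals all_analysis.
From mathcomp Require Import ring lra.

Set Implicit Arguments.
Unset Strict Implicit.
Unset Printing Implicit Defensive.

Import Order.TTheory GRing.Theory Num.Theory.
Import numFieldNormedType.Exports.

Local Open Scope classical_set_scope.
Local Open Scope ring_scope.

Local Notation edist := Defs.edist.

(** * Plane coordinates and similarities *)

Definition px (R : realType) (z : plane R) : R := z ord0 ord0.
Definition py (R : realType) (z : plane R) : R := z ord0 ord_max.
Definition vec (R : realType) (a b : R) : plane R :=
  \row_(i < 2) (if i == ord0 then a else b).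
Definition dsq (R : realType) (z w : plane R) : R :=
  (px z - px w) ^+ 2 + (py z - py w) ^+ 2.

Lemma px_vec (R : realType) (a b : R) : px (vec a b) = a.
Proof. by rewrite /px mxE. Qed.

Lemma py_vec (R : realType) (a b : R) : py (vec a b) = b.
Proof. by rewrite /py mxE. Qed.

Lemma pxD (R : realType) (z w : plane R) : px (z + w) = px z + px w.
Proof. by rewrite /px mxE. Qed.

Lemma pyD (R : realType) (z w : plane R) : py (z + w) = py z + py w.
Proof. by rewrite /py mxE. Qed.

Lemma pxN (R : realType) (z : plane R) : px (- z) = - px z.
Proof. by rewrite /px mxE. Qed.

Lemma pyN (R : realType) (z : plane R) : py (- z) = - py z.
Proof. by rewrite /py mxE. Qed.

Lemma pxZ (R : realType) (l : R) (z : plane R) : px (l *: z) = l * px z.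
Proof. by rewrite /px mxE. Qed.

Lemma pyZ (R : realType) (l : R) (z : plane R) : py (l *: z) = l * py z.
Proof. by rewrite /py mxE. Qed.

Definition coordE := (px_vec, py_vec, pxD, pyD, pxN, pyN, pxZ, pyZ).

Lemma ord2P (i : 'I_2) : i = ord0 \/ i = ord_max.
Proof. by case: i => [[|[|//]] hi]; [left|right]; apply: val_inj. Qed.

Lemma planeP (R : realType) (z w : plane R) :
  px z = px w -> py z = py w -> z = w.
Proof.
move=> hx hy; apply/matrixP => i j; rewrite (ord1 i).
by case: (ord2P j) => ->.
Qed.

Lemma edistE (R : realType) (z w : plane R) : edist z w = Num.sqrt (dsq z w).
Proof.
rewrite /edist /dsq 2!big_ord_recl big_ord0 addr0 /px /py.
by rewrite (_ : lift ord0 ord0 = ord_max) //; apply: val_inj.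
Qed.

Lemma dsq_ge0 (R : realType) (z w : plane R) : 0 <= dsq z w.
Proof. by rewrite addr_ge0 ?sqr_ge0. Qed.

Lemma sqr_edist (R : realType) (z w : plane R) : edist z w ^+ 2 = dsq z w.
Proof. by rewrite edistE sqr_sqrtr ?dsq_ge0. Qed.

Lemma edist_ge0 (R : realType) (z w : plane R) : 0 <= edist z w.
Proof. by rewrite edistE sqrtr_ge0. Qed.

Lemma dsq0 (R : realType) (z w : plane R) : dsq z w = 0 -> z = w.
Proof.
move/eqP; rewrite paddr_eq0 ?sqr_ge0 // !sqrf_eq0 !subr_eq0.
by case/andP => /eqP hx /eqP hy; apply: planeP.
Qed.

Lemma dsqxx (R : realType) (z : plane R) : dsq z z = 0.
Proof. by rewrite /dsq; ring. Qed.

Lemma dsq_gt0 (R : realType) (z w : plane R) : z != w -> 0 < dsq z w.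
Proof.
move=> zw; rewrite lt_neqAle dsq_ge0 andbT eq_sym.
by apply: contra zw => /eqP /dsq0 ->.
Qed.

Lemma dsqC (R : realType) (z w : plane R) : dsq z w = dsq w z.
Proof. by rewrite /dsq; ring. Qed.

Lemma edistC (R : realType) (z w : plane R) : edist z w = edist w z.
Proof. by rewrite !edistE dsqC. Qed.

Lemma edist_gt0 (R : realType) (z w : plane R) : z != w -> 0 < edist z w.
Proof. by move=> h; rewrite edistE sqrtr_gt0 dsq_gt0. Qed.

Lemma edist_le (R : realType) (z w : plane R) (r : R) : 0 <= r ->
  (edist z w <= r) = (dsq z w <= r ^+ 2).
Proof. by move=> r0; rewrite -sqr_edist ler_sqr ?nnegrE ?edist_ge0. Qed.

Lemma edist_lt (R : realType) (z w : plane R) (r : R) : 0 <= r ->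
  (edist z w < r) = (dsq z w < r ^+ 2).
Proof. by move=> r0; rewrite -sqr_edist ltr_sqr ?nnegrE ?edist_ge0. Qed.

Lemma edist_triangle (R : realType) (y x z : plane R) :
  edist x z <= edist x y + edist y z.
Proof.
have h1 := edist_ge0 x y; have h2 := edist_ge0 y z.
rewrite edist_le ?addr_ge0 // sqrrD !sqr_edist.
suff h : (px x - px y) * (px y - px z) + (py x - py y) * (py y - py z)
    <= edist x y * edist y z by move: h; rewrite /dsq; lra.
set c := (X in X <= _); have [c0|c0] := lerP c 0.
  by rewrite (le_trans c0) ?mulr_ge0.
have e0 : 0 <= edist x y * edist y z by rewrite mulr_ge0.
rewrite -(ler_sqr (ltW c0) e0) exprMn !sqr_edist /dsq /c.
set a1 := px x - px y; set a2 := py x - py y.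
set b1 := px y - px z; set b2 := py y - py z.
(* This is Cauchy-Schwarz for [a] and [b]: by Lagrange's identity the two sides differ by the square
   of the cross product. *)
have := sqr_ge0 (a1 * b2 - a2 * b1); nra.
Qed.

(** * Convexity and interiors in terms of the Euclidean distance *)

Lemma convex_setP (R : realType) (D : set (plane R)) y z l :
  @convex_set R (plane R) D -> D y -> D z -> 0 <= l <= 1 -> D (y + l *: (z - y)).
Proof.
move=> cD Dy Dz /andP[l0 l1].
have hl : Itv.spec (@Itv.num_sem R) (Itv.Real `[0%Z, 1%Z]) l.
  by rewrite /= /Itv.num_sem /= in_itv /= num_real l0 l1.
have := cD z y (@Itv.mk _ (@Itv.num_sem R) _ l hl) (mem_set Dz) (mem_set Dy).
move=> /set_mem; congr D; rewrite /conv /= /unstable.onem.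
by apply: planeP; rewrite !coordE /=; ring.
Qed.

(** Passes from max-norm balls to Euclidean ones: the Euclidean ball of radius [r] lies in the
    max-norm ball of radius [r] and contains the one of radius [r / 2]. *)
Lemma interior_edistP (R : realType) (A : set (plane R)) (z : plane R) :
  A° z <-> exists2 r, 0 < r & forall w, edist w z < r -> A w.
Proof.
split.
  move=> /nbhs_ballP[r /= r0 hr]; exists r => // w; rewrite edist_lt ?ltW // => h.
  have [h1 h2] : (px w - px z) ^+ 2 < r ^+ 2 /\ (py w - py z) ^+ 2 < r ^+ 2.
    have := sqr_ge0 (px w - px z); have := sqr_ge0 (py w - py z).
    by move: h; rewrite /dsq; split; lra.
  apply: hr; split => // i j; rewrite (ord1 i).
  rewrite -ball_normE /= distrC -ltr_sqr ?nnegrE ?normr_ge0 ?ltW //.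
  by rewrite real_normK ?num_real //; case: (ord2P j) => ->.
move=> [r r0 hr]; apply/nbhs_ballP; exists (r / 2) => /=; first by rewrite divr_gt0.
move=> w [_ hw]; apply: hr; rewrite edist_lt ?ltW //.
have c2 j : (w ord0 j - z ord0 j) ^+ 2 < (r / 2) ^+ 2.
  have := hw ord0 j; rewrite -ball_normE /= distrC => h.
  rewrite -[X in X < _]real_normK ?num_real //.
  by rewrite ltr_sqr ?nnegrE ?normr_ge0 ?divr_ge0 // ltW.
have h1 := c2 ord0; have h2 := c2 ord_max.
have := sqr_ge0 r; move: h1 h2; rewrite expr_div_n /dsq /px /py; lra.
Qed.

(** The homothety of centre [x] and ratio [l] shrinks a ball around [y], and convexity keeps the
    image inside [P]. The end [x] itself may lie on the boundary. *)
Lemma interior_cone (R : realType) (P : set (plane R)) x y l :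
  @convex_set R (plane R) P -> P x -> P° y -> 0 < l <= 1 -> P° (x + l *: (y - x)).
Proof.
move=> cP Px /interior_edistP[r r0 hr] /andP[l0 l1].
apply/interior_edistP; exists (l * r); first by rewrite mulr_gt0.
move=> w hw; have ln0 : l != 0 by rewrite gt_eqF.
have -> : w = x + l *: ((x + l^-1 *: (w - x)) - x).
  by apply: planeP; rewrite !coordE; field.
apply: convex_setP => //; last by rewrite ltW.
apply: hr; move: hw; rewrite !edist_lt ?mulr_ge0 ?ltW //.
have -> : dsq w (x + l *: (y - x)) = l ^+ 2 * dsq (x + l^-1 *: (w - x)) y.
  by rewrite /dsq !coordE; field.
by rewrite exprMn ltr_pM2l // exprn_gt0.
Qed.

(** In complex notation this is [z |-> P + (Q - P) / (q - p) * (z - p)], the direct similarity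
    taking [p] to [P] and [q] to [Q]; [a + i b] is the complex quotient. *)
Definition simmap (R : realType) (p q P Q z : plane R) : plane R :=
  let N := dsq q p in
  let a := ((px Q - px P) * (px q - px p) + (py Q - py P) * (py q - py p)) / N in
  let b := ((py Q - py P) * (px q - px p) - (px Q - px P) * (py q - py p)) / N in
  vec (px P + a * (px z - px p) - b * (py z - py p))
      (py P + b * (px z - px p) + a * (py z - py p)).

Section simmap.
Variables (R : realType) (p q P Q : plane R).
Hypotheses (pq : p != q) (PQ : P != Q).

Let Npq : dsq q p != 0. Proof. by rewrite gt_eqF // dsq_gt0 // eq_sym. Qed.
Let NPQ : dsq Q P != 0. Proof. by rewrite gt_eqF // dsq_gt0 // eq_sym. Qed.

Lemma simmap_fst : simmap p q P Q p = P.
Proof. by apply: planeP; rewrite /simmap !coordE; ring. Qed.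

Lemma simmap_snd : simmap p q P Q q = Q.
Proof.
by move: Npq; rewrite /dsq => h; apply: planeP; rewrite /simmap !coordE /dsq; field.
Qed.

Lemma simmapK z : simmap p q P Q (simmap P Q p q z) = z.
Proof.
by move: Npq NPQ; rewrite /dsq => h h'; apply: planeP;
  rewrite /simmap !coordE /dsq; field; rewrite h h'.
Qed.

Lemma dsq_simmap z w :
  dsq (simmap p q P Q z) (simmap p q P Q w) = dsq Q P / dsq q p * dsq z w.
Proof.
by move: Npq; rewrite /dsq => h; rewrite /simmap !coordE /dsq; field.
Qed.

Lemma edist_simmap z w :
  edist (simmap p q P Q z) (simmap p q P Q w)
  = edist Q P / edist q p * edist z w.
Proof.
rewrite !edistE dsq_simmap sqrtrM ?divr_ge0 ?dsq_ge0 //.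
by rewrite sqrtrM ?dsq_ge0 // sqrtrV ?dsq_ge0.
Qed.

Lemma similarity_simmap : similarity (simmap p q P Q).
Proof.
exists (edist Q P / edist q p); last exact: edist_simmap.
by rewrite divr_gt0 // edist_gt0 // eq_sym.
Qed.

End simmap.

Lemma interior_simmap (R : realType) (p q P Q : plane R) (D : set (plane R)) z :
  p != q -> P != Q -> D° z -> (simmap p q P Q @` D)° (simmap p q P Q z).
Proof.
move=> pq PQ /interior_edistP[r r0 hr].
have k0 : 0 < edist q p / edist Q P by rewrite divr_gt0 // edist_gt0 // eq_sym.
apply/interior_edistP; exists ((edist q p / edist Q P)^-1 * r).
  by rewrite mulr_gt0 ?invr_gt0.
move=> w hw; exists (simmap P Q p q w); last exact: simmapK.
by apply: hr; rewrite -(@simmapK _ P Q p q PQ pq z) edist_simmap // -ltr_pdivlMl.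
Qed.

(** * Exposed points and equal tangents *)

Definition dot (R : realType) (u v : plane R) : R := px u * px v + py u * py v.
Definition crs (R : realType) (u v : plane R) : R := px u * py v - py u * px v.

(** [u] is the unit outer normal of a support line that touches [D] at [e] alone; strictness rules
    out contact along a segment. *)
Definition exposed (R : realType) (D : set (plane R)) (e u : plane R) : Prop :=
  [/\ D e, dot u u = 1 & forall y, D y -> y != e -> dot u (y - e) < 0].

Lemma continuous_dsq (R : realType) (c : plane R) : continuous (fun y => dsq y c).
Proof.
move=> y.
have cc (j : 'I_2) : {for y, continuous (fun z : plane R => z ord0 j - c ord0 j)}.
  by apply: continuousB; [exact: coord_continuous | exact: cst_continuous].
have -> : (fun z => dsq z c) =
    ((fun z : plane R => z ord0 ord0 - c ord0 ord0)
      * (fun z : plane R => z ord0 ord0 - c ord0 ord0))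
    + ((fun z : plane R => z ord0 ord_max - c ord0 ord_max)
      * (fun z : plane R => z ord0 ord_max - c ord0 ord_max)).
  by apply/funext => z; rewrite /dsq !expr2.
by apply: continuousD; apply: continuousM; apply: cc.
Qed.

Lemma farthest_point (R : realType) (D : set (plane R)) (c : plane R) :
  compact D -> D !=set0 -> exists2 e, D e & forall y, D y -> dsq y c <= dsq e c.
Proof.
move=> cD D0.
have [e /set_mem De he] := EVT_max_rV D0 cD
  (continuous_subspaceT (@continuous_dsq R c)).
by exists e => // y Dy; apply: he; apply: mem_set.
Qed.

Lemma nearest_point (R : realType) (D : set (plane R)) (c : plane R) :
  compact D -> D !=set0 -> exists2 e, D e & forall y, D y -> dsq e c <= dsq y c.
Proof.
move=> cD D0.
have [e /set_mem De he] := EVT_min_rV D0 cD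
  (continuous_subspaceT (@continuous_dsq R c)).
by exists e => // y Dy; apply: he; apply: mem_set.
Qed.

(** [D] lies in the disc around [c] through [e], and the tangent of that disc at [e] meets it
    nowhere else. All exposed points constructed below arise in this way. *)
Lemma exposed_farthest (R : realType) (D : set (plane R)) (c e : plane R) :
  D e -> e != c -> (forall y, D y -> dsq y c <= dsq e c) ->
  exposed D e ((edist e c)^-1 *: (e - c)).
Proof.
move=> De ec he; have r0 := edist_gt0 ec; have rn0 : edist e c != 0 by rewrite gt_eqF.
split=> // [|y Dy ye].
  have := sqr_edist e c; rewrite /dot !coordE /dsq => h.
  apply: (mulfI (expf_neq0 2 rn0)); rewrite mulr1 {2}h; field.
  exact: rn0.
have hp : 0 < edist e c * 2 by rewrite mulr_gt0.
rewrite -(pmulr_rlt0 _ hp).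
have := he y Dy; have := dsq_gt0 ye; rewrite /dsq /dot !coordE => h1 h2.
set l := edist e c in rn0 *.
have -> : l * 2 * (l^-1 * (px e - px c) * (px y - px e)
   + l^-1 * (py e - py c) * (py y - py e))
  = 2 * ((px e - px c) * (px y - px e) + (py e - py c) * (py y - py e)) by field.
lra.
Qed.

(** * Parallelism, cross products and homothetic triangles *)

Lemma parallelP (R : realType) (v w : plane R) : crs v w = 0 -> w != 0 ->
  exists k, v = k *: w.
Proof.
move=> h w0; have W : 0 < dot w w.
  by have := dsq_gt0 w0; rewrite /dsq /dot /px /py !mxE !subr0 !expr2.
exists (dot v w / dot w w); have Wn : dot w w != 0 by rewrite gt_eqF.
have h1 : px v * py w = py v * px w by move: h; rewrite /crs; lra.
move: Wn; rewrite /dot => Wn; apply: planeP; rewrite !coordE;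
  apply: (mulIf Wn); rewrite mulrAC mulfVK //.
  have -> : (px v * px w + py v * py w) * px w
    = px v * px w * px w + py w * (py v * px w) by ring.
  by rewrite -h1; ring.
have -> : (px v * px w + py v * py w) * py w
    = px w * (px v * py w) + py v * py w * py w by ring.
by rewrite h1; ring.
Qed.

(** A line meets the unit circle at most twice: a point [u2 + k *: (u2 - u3)] on the circle
    satisfies [k * (k + 1) = 0], so it is [u2] or [u3]. *)
Lemma crs_chords (R : realType) (u1 u2 u3 : plane R) :
  dot u1 u1 = 1 -> dot u2 u2 = 1 -> dot u3 u3 = 1 ->
  u1 != u2 -> u2 != u3 -> u1 != u3 -> crs (u1 - u2) (u2 - u3) != 0.
Proof.
move=> n1 n2 n3 d12 d23 d13; apply/eqP => h.
have w0 : u2 - u3 != 0 by rewrite subr_eq0.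
have [k hk] := parallelP h w0.
have e1 : u1 = u2 + k *: (u2 - u3) by rewrite -hk addrC subrK.
have W : dot (u2 - u3) (u2 - u3) != 0.
  have -> : dot (u2 - u3) (u2 - u3) = dsq u2 u3 by rewrite /dot /dsq !coordE; ring.
  by rewrite gt_eqF // dsq_gt0.
have : k * (k + 1) * dot (u2 - u3) (u2 - u3) = 0.
  transitivity (dot u1 u1 - dot u2 u2 - k * (dot u2 u2 - dot u3 u3)).
    by rewrite e1 /dot !coordE; ring.
  by rewrite n1 n2 n3; ring.
move/eqP; rewrite !mulf_eq0 (negPf W) orbF => /orP[|] /eqP k0.
  by move/eqP: d12; apply; rewrite e1 k0 scale0r addr0.
move/eqP: d13; apply; rewrite e1 (_ : k = -1); last by lra.
by apply: planeP; rewrite !coordE; ring.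
Qed.

Lemma crs_self (R : realType) (u : plane R) : crs u u = 0.
Proof. by rewrite /crs; ring. Qed.

Lemma crsC (R : realType) (u v : plane R) : crs v u = - crs u v.
Proof. by rewrite /crs; ring. Qed.

Lemma crs_neq (R : realType) (u v : plane R) : crs u v != 0 -> u != v.
Proof. by apply: contra => /eqP ->; rewrite crs_self. Qed.

(** The [e_i] and the [u_i] form triangles with parallel sides. The closing relation of the sides,
    together with the independence of [u1 - u2] and [u2 - u3], forces one ratio [s] for all three
    sides, hence a single homothety. *)
Lemma common_center (R : realType) (e1 e2 e3 u1 u2 u3 : plane R) :
  dot u1 u1 = 1 -> dot u2 u2 = 1 -> dot u3 u3 = 1 ->
  u1 != u2 -> u2 != u3 -> u1 != u3 ->
  crs (e1 - e2) (u1 - u2) = 0 -> crs (e2 - e3) (u2 - u3) = 0 ->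
  crs (e1 - e3) (u1 - u3) = 0 ->
  exists c s, [/\ e1 = c + s *: u1, e2 = c + s *: u2 & e3 = c + s *: u3].
Proof.
move=> n1 n2 n3 d12 d23 d13 h12 h23 h13.
have K := crs_chords n1 n2 n3 d12 d23 d13.
have w12 : u1 - u2 != 0 by rewrite subr_eq0.
have [s12 k12] := parallelP h12 w12.
have w23 : u2 - u3 != 0 by rewrite subr_eq0.
have [s23 k23] := parallelP h23 w23.
have w13 : u1 - u3 != 0 by rewrite subr_eq0.
have [s13 k13] := parallelP h13 w13.
have E : (s12 - s13) *: (u1 - u2) + (s23 - s13) *: (u2 - u3) = 0.
  have -> : (s12 - s13) *: (u1 - u2) + (s23 - s13) *: (u2 - u3)
      = s12 *: (u1 - u2) + s23 *: (u2 - u3) - s13 *: (u1 - u3).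
    by apply: planeP; rewrite !coordE; ring.
  by rewrite -k12 -k23 -k13; apply: planeP; rewrite !coordE /px /py mxE; ring.
have Ex : px ((s12 - s13) *: (u1 - u2) + (s23 - s13) *: (u2 - u3)) = 0.
  by rewrite E /px mxE.
have Ey : py ((s12 - s13) *: (u1 - u2) + (s23 - s13) *: (u2 - u3)) = 0.
  by rewrite E /py mxE.
have h1 : (s12 - s13) * crs (u1 - u2) (u2 - u3) = 0.
  transitivity (crs ((s12 - s13) *: (u1 - u2) + (s23 - s13) *: (u2 - u3)) (u2 - u3)).
    by rewrite /crs !coordE; ring.
  by rewrite /crs Ex Ey; ring.
move/eqP: h1; rewrite mulf_eq0 (negPf K) orbF subr_eq0 => /eqP s1.
have h2 : (s23 - s13) * crs (u1 - u2) (u2 - u3) = 0.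
  transitivity (crs (u1 - u2) ((s12 - s13) *: (u1 - u2) + (s23 - s13) *: (u2 - u3))).
    by rewrite /crs !coordE; ring.
  by rewrite /crs Ex Ey; ring.
move/eqP: h2; rewrite mulf_eq0 (negPf K) orbF subr_eq0 => /eqP s2.
exists (e1 - s13 *: u1), s13; split; first by rewrite subrK.
  move: k12; rewrite s1 => /(canRL (subrK _)) ->.
  by apply: planeP; rewrite !coordE; ring.
move: k13 => /(canRL (subrK _)) ->.
by apply: planeP; rewrite !coordE; ring.
Qed.

(** Taking the farthest point from some [v] outside the bounding square controls the direction of
    the normal, which is that of [e - v]. *)
Lemma exposed_direction (R : realType) (D : set (plane R)) (K : R) (v : plane R) :
  compact D -> D !=set0 -> (forall y, D y -> `|px y| < K /\ `|py y| < K) ->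
  K <= `|px v| \/ K <= `|py v| ->
  exists e u l, [/\ exposed D e u, 0 < l & l *: u = e - v].
Proof.
move=> cD D0 hK hv; have [e De he] := farthest_point v cD D0.
have ev : e != v.
  by apply: contraPneq hv => <-; have [h1 h2] := hK e De; rewrite !leNgt h1 h2; case.
exists e, ((edist e v)^-1 *: (e - v)), (edist e v).
split; [exact: exposed_farthest|exact: edist_gt0|].
by rewrite scalerA mulfV ?scale1r // gt_eqF // edist_gt0.
Qed.

Lemma compact_coord_bounded (R : realType) (D : set (plane R)) : compact D ->
  exists2 K : R, 0 < K & forall y, D y -> `|px y| < K /\ `|py y| < K.
Proof.
move=> cD; have [D0|D0] := pselect (D !=set0); last first.
  by exists 1 => // y Dy; case: D0; exists y.
have [e De he] := farthest_point 0 cD D0.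
have e0 : 0 <= edist e 0 := edist_ge0 e 0.
exists (edist e 0 + 1); first by rewrite ltr_wpDl.
have aux (a b : R) : 0 <= b -> a ^+ 2 <= b ^+ 2 -> `|a| < b + 1.
  move=> b0 h; apply: (@le_lt_trans _ _ b); last by rewrite ltrDl.
  by rewrite -ler_sqr ?nnegrE // real_normK ?num_real.
move=> y Dy; have h : dsq y 0 <= edist e 0 ^+ 2 by rewrite sqr_edist he.
have hx := sqr_ge0 (px y); have hy := sqr_ge0 (py y).
have d0 : dsq y 0 = px y ^+ 2 + py y ^+ 2 by rewrite /dsq /px /py !mxE !subr0.
by split; apply: aux => //; move: h; rewrite d0; lra.
Qed.

Lemma crs_scale (R : realType) (u v : plane R) (l m : R) :
  0 < crs (l *: u) (m *: v) -> crs u v != 0.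
Proof.
have -> : crs (l *: u) (m *: v) = l * m * crs u v by rewrite /crs !coordE; ring.
by move=> h; apply: contraTneq h => ->; rewrite mulr0 ltxx.
Qed.

Lemma center_uniq (R : realType) (c c' u v : plane R) (s s' : R) :
  c + s *: u = c' + s' *: u -> c + s *: v = c' + s' *: v -> u != v ->
  c = c' /\ s = s'.
Proof.
move=> h1 h2 uv; have E : (s - s') *: (u - v) = 0.
  have -> : (s - s') *: (u - v) = (c + s *: u - (c' + s' *: u))
    - (c + s *: v - (c' + s' *: v)) by apply: planeP; rewrite !coordE; ring.
  by rewrite h1 h2 !subrr.
move/eqP: E; rewrite scaler_eq0 !subr_eq0 (negPf uv) orbF => /eqP ss.
by split=> //; move: h1; rewrite ss => /addIr.
Qed.

Lemma dot_neq0 (R : realType) (u : plane R) : dot u u = 1 -> u != 0.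
Proof.
move=> h; apply/eqP => u0; move: h; rewrite u0 /dot /px /py !mxE !mul0r addr0.
by move/eqP; rewrite eq_sym oner_eq0.
Qed.

Lemma crs_trans0 (R : realType) (u v w : plane R) : dot u u = 1 ->
  crs u v = 0 -> crs u w = 0 -> crs v w = 0.
Proof.
move=> n h1 h2; have u0 := dot_neq0 n.
have vu : crs v u = 0 by rewrite crsC h1 oppr0.
have wu : crs w u = 0 by rewrite crsC h2 oppr0.
have [k ->] := parallelP vu u0; have [l ->] := parallelP wu u0.
by rewrite /crs !coordE; ring.
Qed.

(** * Equal tangents put all exposed points on one circle *)

Section equal_tangents.
Variables (R : realType) (D : set (plane R)).
Hypotheses (cD : compact D) (D0 : D !=set0).
Hypothesis tangents : forall e1 u1 e2 u2,
  exposed D e1 u1 -> exposed D e2 u2 -> crs u1 u2 != 0 ->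
  crs (e1 - e2) (u1 - u2) = 0.

Lemma exposed_triple (e1 u1 e2 u2 e3 u3 : plane R) :
  exposed D e1 u1 -> exposed D e2 u2 -> exposed D e3 u3 ->
  crs u1 u2 != 0 -> crs u2 u3 != 0 -> crs u1 u3 != 0 ->
  exists c s, [/\ e1 = c + s *: u1, e2 = c + s *: u2 & e3 = c + s *: u3].
Proof.
move=> x1 x2 x3 h12 h23 h13.
have [_ n1 _] := x1; have [_ n2 _] := x2; have [_ n3 _] := x3.
by apply: common_center => //; try exact: crs_neq; apply: tangents.
Qed.

Lemma three_exposed : exists e1 u1 e2 u2 e3 u3,
  [/\ exposed D e1 u1, exposed D e2 u2 & exposed D e3 u3] /\
  [/\ crs u1 u2 != 0, crs u2 u3 != 0 & crs u1 u3 != 0].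
Proof.
have [K K0 hK] := compact_coord_bounded cD.
have K4 : K <= `|- (4 * K)| by rewrite normrN ger0_norm ?mulr_ge0 ?ltW //; lra.
have aux (v : plane R) : K <= `|px v| \/ K <= `|py v| ->
    exists e u l, [/\ exposed D e u, l *: u = e - v,
      - K < px e < K & - K < py e < K].
  move=> hv; have [e [u [l [xe l0 he]]]] := exposed_direction cD D0 hK hv.
  exists e, u, l; have [De _ _] := xe.
  by have [] := hK e De; rewrite !ltr_norml; split.
(* From these three viewpoints every [e - v] has its large coordinates in [(3K, 5K)] and its small
   ones in [(-K, K)], so each cross product exceeds [9K^2 - 5K^2]. *)
have [|e1 [u1 [l1 [x1 h1 /andP[a1 b1] /andP[c1 d1]]]]] := aux (vec (- (4 * K)) 0).
  by left; rewrite px_vec.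
have [|e2 [u2 [l2 [x2 h2 /andP[a2 b2] /andP[c2 d2]]]]] := aux (vec (- (4 * K)) (- (4 * K))).
  by left; rewrite px_vec.
have [|e3 [u3 [l3 [x3 h3 /andP[a3 b3] /andP[c3 d3]]]]] := aux (vec 0 (- (4 * K))).
  by right; rewrite py_vec.
exists e1, u1, e2, u2, e3, u3; split; first by split.
split.
- apply: (@crs_scale _ _ _ l1 l2); rewrite h1 h2 /crs !coordE !opprK.
  by nra.
- apply: (@crs_scale _ _ _ l2 l3); rewrite h2 h3 /crs !coordE !opprK.
  by nra.
- apply: (@crs_scale _ _ _ l1 l3); rewrite h1 h3 /crs !coordE !opprK.
  by nra.
Qed.

(** Three pairwise non-parallel normals fix [c] and [s]. A further normal is parallel to at most one
    of them, so it forms a triple with the other two, and two distinct normals already determine the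
    centre and the ratio. *)
Lemma exposed_center : exists c s, forall e u, exposed D e u -> e = c + s *: u.
Proof.
have [e1 [u1 [e2 [u2 [e3 [u3 [[x1 x2 x3] [h12 h23 h13]]]]]]]] := three_exposed.
have [c [s [E1 E2 E3]]] := exposed_triple x1 x2 x3 h12 h23 h13.
have aux e u e' u' e'' u'' : exposed D e u -> exposed D e' u' -> exposed D e'' u'' ->
    crs u u' != 0 -> crs u u'' != 0 -> crs u' u'' != 0 ->
    e' = c + s *: u' -> e'' = c + s *: u'' -> e = c + s *: u.
  move=> x x' x'' k k' k'' E' E''.
  have [c' [s' [-> F' F'']]] := exposed_triple x x' x'' k k'' k'.
  have [-> -> //] : c' = c /\ s' = s.
  by apply: (@center_uniq _ _ _ u' u''); rewrite -?F' -?F'' //; exact: crs_neq.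
exists c, s => e u xe; have [_ n _] := xe.
have [k1|k1] := eqVneq (crs u u1) 0; have [k2|k2] := eqVneq (crs u u2) 0.
- by move: h12; rewrite (crs_trans0 n k1 k2) eqxx.
- have [k3|k3] := eqVneq (crs u u3) 0; last exact: (aux _ _ _ _ _ _ xe x2 x3).
  by move: h13; rewrite (crs_trans0 n k1 k3) eqxx.
- have [k3|k3] := eqVneq (crs u u3) 0; last exact: (aux _ _ _ _ _ _ xe x1 x3).
  by move: h23; rewrite (crs_trans0 n k2 k3) eqxx.
- exact: (aux _ _ _ _ _ _ xe x1 x2).
Qed.

End equal_tangents.

(** A half plane separating [D] from [w] is approximated by a huge disc whose centre recedes from
    [w] along the line through [w] and the nearest point [p]. The lower bound [s] on its radius
    serves the comparison with a disc of radius [s]. *)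
Lemma separating_ball (R : realType) (D : set (plane R)) (w : plane R) (s : R) :
  compact D -> @convex_set R (plane R) D -> D !=set0 -> ~ D w -> 0 <= s ->
  exists c e, [/\ D e, forall y, D y -> dsq y c <= dsq e c, 0 < dsq e c,
    s <= edist e c & dsq e c < dsq w c].
Proof.
move=> cD convD D0 Dw s0.
have [p Dp hp] := nearest_point w cD D0.
have [f Df hf] := farthest_point p cD D0.
have N0 : 0 < dsq p w by apply: dsq_gt0; apply/eqP => E; apply: Dw; rewrite -E.
have hn y : D y -> dot (y - p) (w - p) <= 0.
  move=> Dy; rewrite leNgt; apply/negP => d0.
  set d := dot (y - p) (w - p) in d0.
  have q0 : 0 <= dsq y p := dsq_ge0 _ _.
  have dq : 0 < d + dsq y p by rewrite ltr_pwDl.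
  have ht : 0 <= d / (d + dsq y p) <= 1.
    by rewrite divr_ge0 ?(ltW d0) ?(ltW dq) //= ler_pdivrMr // mul1r lerDl.
  have := hp _ (convex_setP convD Dp Dy ht).
  have dqn : d + dsq y p != 0 by rewrite gt_eqF.
  (* If the angle at [p] were acute, moving by [t] towards [y] would come closer to [w]; the
     denominator [d + dsq y p] keeps [t] at most 1. *)
  set t := d / _ in ht *.
  have tq : t * (d + dsq y p) = d by rewrite /t mulfVK.
  have t0 : 0 < t by rewrite divr_gt0.
  have -> : dsq (p + t *: (y - p)) w = dsq p w - t * (2 * d - t * dsq y p).
    by rewrite /d /dot /dsq !coordE; ring.
  move=> h; have : t * (2 * d - t * dsq y p) <= 0 by lra.
  rewrite pmulr_rle0 // => h2.
  have : 0 < t * d by rewrite mulr_gt0.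
  move: tq; rewrite mulrDr; lra.
set N := dsq p w in N0; set B := dsq f p in hf.
have Nn : N != 0 by rewrite gt_eqF.
have B0 : 0 <= B := dsq_ge0 _ _.
(* Seen from [c], the squared distance is at most [B + M^2 N] on [D] and equals [M^2 N + 2 M N + N]
   at [w]. This [M] gives [M N = B + s^2 + N], which settles both the separation and the bound on
   the radius. *)
pose M := (B + s ^+ 2) / N + 1.
have M1 : 1 <= M by rewrite lerDr divr_ge0 ?addr_ge0 ?sqr_ge0 // ltW.
have MN : M * N = B + s ^+ 2 + N by rewrite /M mulrDl mul1r mulfVK.
have sq := sqr_ge0 s.
pose c := p - M *: (w - p).
have [e De he] := farthest_point c cD D0.
have hM : M * (M * N) <= dsq e c.
  have := he p Dp; congr (_ <= _); rewrite /N /c /dsq !coordE; ring.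
have hM2 : M * N <= M * (M * N) by rewrite ler_peMl // mulr_ge0 ?(ltW N0); lra.
exists c, e; split => //.
- lra.
- by rewrite edistE -[s]ger0_norm // -sqrtr_sqr ler_wsqrtr //; lra.
have -> : dsq w c = M * (M * N) + 2 * (M * N) + N.
  by rewrite /N /c /dsq !coordE; ring.
have -> : dsq e c = dsq e p + 2 * M * dot (e - p) (w - p) + M * (M * N).
  by rewrite /N /c /dsq /dot !coordE; ring.
have := hf e De; have := hn e De => d1 d2.
have : M * dot (e - p) (w - p) <= 0 by rewrite mulr_ge0_le0 //; lra.
lra.
Qed.

Lemma equal_tangents_circular (R : realType) (D : set (plane R)) :
  convex_disc D ->
  (forall e1 u1 e2 u2, exposed D e1 u1 -> exposed D e2 u2 -> crs u1 u2 != 0 ->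
    crs (e1 - e2) (u1 - u2) = 0) ->
  circular_disc D.
Proof.
move=> [cD convD [z0 iz0]] tangents.
have Dz0 := interior_subset iz0.
have D0 : D !=set0 by exists z0.
have [c [s hcs]] := exposed_center cD D0 tangents.
have [e De he] := farthest_point c cD D0.
have ec : e != c.
  apply/eqP => E; have z0c y : D y -> y = c.
    by move=> /he; rewrite E dsqxx => h; apply: dsq0; apply/eqP; rewrite eq_le h dsq_ge0.
  move/interior_edistP: iz0 => [r r0 hr].
  have /z0c : D (z0 + vec (r / 2) 0).
    apply: hr; rewrite edist_lt ?ltW // /dsq !coordE.
    have := exprn_gt0 2 r0; lra.
  rewrite (z0c _ Dz0) => /(congr1 (@px R)); rewrite !coordE; lra.
have r0 := edist_gt0 ec; have rn : edist e c != 0 by rewrite gt_eqF.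
(* The farthest point from [c] is exposed with normal along [e - c], so the formula [e = c + s *: u]
   identifies [s] with the circumradius about [c]. *)
have es : edist e c = s.
  have /eqP := hcs _ _ (exposed_farthest De ec he).
  rewrite addrC -subr_eq scalerA -subr_eq0 -{1}[e - c]scale1r -scalerBl scaler_eq0.
  rewrite !subr_eq0 (negPf ec) orbF => /eqP h.
  by apply: (mulIf (invr_neq0 rn)); rewrite mulfV.
exists c, s; split; first by rewrite -es.
have s0 : 0 <= s by rewrite -es ltW.
apply/seteqP; split => [y Dy|w /= hw]; first by rewrite /= edist_le // -es sqr_edist he.
apply: contrapT => Dw.
have [c' [f [Df hf f0 sf fw]]] := separating_ball cD convD D0 Dw s0.
have fc : f != c' by apply: contraTneq f0 => ->; rewrite dsqxx ltxx.
have F := hcs _ _ (exposed_farthest Df fc hf).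
have rf0 := edist_gt0 fc; have rfn : edist f c' != 0 by rewrite gt_eqF.
(* The normal at [f] is shared: [f = c + s *: u] and [f = c' + edist f c' *: u]. Hence the disc
   around [c] is internally tangent to the one around [c'], lies inside it, and cannot contain
   [w]. *)
have hcc : edist c c' <= edist f c' - s.
  have sub0 : 0 <= edist f c' - s by rewrite subr_ge0.
  rewrite edist_le //.
  have [_ n _] := exposed_farthest Df fc hf.
  set u := _^-1 *: _ in F n; have cu : c = f - s *: u by apply/eqP; rewrite eq_sym subr_eq -F.
  have fu : f = c' + edist f c' *: u by rewrite /u scalerA mulfV // scale1r addrC subrK.
  have -> : dsq c c' = (edist f c' - s) ^+ 2 * dot u u.
    have -> : c = c' + (edist f c' - s) *: u by rewrite scalerBl addrA -fu.
    by move: (edist f c' - s) => l; rewrite /dsq /dot !coordE; ring.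
  by rewrite n mulr1.
have : edist w c' <= edist f c'.
  by apply: (le_trans (edist_triangle c _ _)); lra.
by rewrite edist_le ?edist_ge0 // sqr_edist leNgt fw.
Qed.

(** * A point with unequal tangents *)

(** The frame [a], [b] may have either orientation, so mirror-image configurations need no separate
    treatment. *)
Definition polar (R : realType) (x a b : plane R) (r t : R) : plane R :=
  x + r *: (cos t *: a + sin t *: b).

Lemma dsq_polar (R : realType) (x a b : plane R) (r t : R) :
  dot a a = 1 -> dot b b = 1 -> dot a b = 0 -> dsq (polar x a b r t) x = r ^+ 2.
Proof.
move=> aa bb ab; have -> : dsq (polar x a b r t) x = r ^+ 2 *
    (cos t ^+ 2 * dot a a + sin t ^+ 2 * dot b b + 2 * cos t * sin t * dot a b).
  by rewrite /polar /dsq /dot !coordE; ring.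
by rewrite aa bb ab mulr0 addr0 !mulr1 cos2Dsin2 mulr1.
Qed.

Lemma dotC (R : realType) (u v : plane R) : dot u v = dot v u.
Proof. by rewrite /dot; ring. Qed.

Lemma dot_polar (R : realType) (u x a b : plane R) (r t r' t' : R) :
  dot u (polar x a b r t - polar x a b r' t') =
  r * (cos t * dot u a + sin t * dot u b)
  - r' * (cos t' * dot u a + sin t' * dot u b).
Proof. by rewrite /polar /dot !coordE; ring. Qed.

Lemma lagrange (R : realType) (u v w z : plane R) :
  crs u v * crs w z = dot u w * dot v z - dot u z * dot v w.
Proof. by rewrite /crs /dot; ring. Qed.

(** [x] is the intersection of the two support lines. The distance from [e1] to the second line is
    [T1 * |C|], since [|C|] is the sine of the angle between the lines; likewise for [T2]. Thus [T1]
    and [T2] are the tangent lengths. *)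
Lemma unequal_tangents_gap (R : realType) (D : set (plane R))
    (e1 u1 e2 u2 : plane R) :
  exposed D e1 u1 -> exposed D e2 u2 -> crs u1 u2 != 0 ->
  0 < dot u2 (e2 - e1) < dot u1 (e1 - e2) ->
  exists x a b th T1 T2,
    [/\ dot a a = 1, dot b b = 1, dot a b = 0 & 0 < T1 < T2] /\
    [/\ 0 < th < pi *+ 2, D (polar x a b T2 0), D (polar x a b T1 th) &
        forall r t, T1 < r < T2 -> 0 <= t <= th -> ~ D (polar x a b r t)].
Proof.
move=> [D1 n1 h1] [D2 n2 h2] C0 /andP[A0 A12].
pose C := crs u1 u2; pose k := dot u1 u2.
pose g := Num.sg C; have gC : g * C = `|C| by rewrite /g -normrEsg.
have g2 : g * g = 1 by rewrite -expr2 sqr_sg C0.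
have CC : 0 < `|C| by rewrite normr_gt0.
have CCn : `|C| != 0 by rewrite gt_eqF.
have kC : k ^+ 2 + C ^+ 2 = 1.
  rewrite [C ^+ 2]expr2 lagrange n1 n2 [dot u2 u1](_ : _ = k); first by rewrite /k; ring.
  by rewrite /k /dot; ring.
have C2 : 0 < C ^+ 2 by rewrite exprn_even_gt0.
have k1 : -1 < - k < 1 by apply/andP; split; nra.
pose J (u : plane R) := vec (- py u) (px u).
(* [a] points from [x] to [e2]; the sign [g] selects this orientation of the tangent line. *)
pose a := g *: J u2; pose T1 := dot u2 (e2 - e1) / `|C|.
pose T2 := dot u1 (e1 - e2) / `|C|.
pose x := e2 - T2 *: a.
have Cg : g / `|C| = C^-1.
  have g0 : g != 0 by rewrite sgr_eq0.
  by rewrite -gC invfM mulrA mulfV // mul1r.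
have xe1 : e1 = x + T1 *: (- g *: J u1).
  have Cn : px u1 * py u2 - py u1 * px u2 != 0 by exact: C0.
  have -> : T1 *: (- g *: J u1) = (- dot u2 (e2 - e1) / C) *: J u1.
    by rewrite scalerA /T1 -Cg; congr (_ *: _); ring.
  have -> : x = e2 - (dot u1 (e1 - e2) / C) *: J u2.
    by rewrite /x /a scalerA /T2 -Cg; congr (_ - _ *: _); ring.
  by apply: planeP; rewrite /J /C /crs /dot !coordE; field.
(* [acos (- k)] is the visual angle of the contact points from [x]. The sector turns the other way
   round, from [e2] on the outer side [u2] to [e1]. *)
pose th := pi *+ 2 - acos (- k).
have costh : cos th = - k.
  rewrite /th -cosN opprB cosB cos2pi sin2pi mulr1 mulr0 addr0 acosK //.
  by rewrite in_itv /=; case/andP: k1 => ? ?; rewrite !ltW.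
have kk : -1 <= - k <= 1 by case/andP: k1 => ? ?; rewrite !ltW.
have sinth : sin th = - `|C|.
  rewrite /th sinB cos2pi sin2pi mul0r mul1r sub0r sin_acos //.
  by rewrite sqrrN (_ : 1 - k ^+ 2 = C ^+ 2) ?sqrtr_sqr //; lra.
have acos_pos : 0 < acos (- k) by apply: acos_gt0; case/andP: k1 => ? ?; rewrite ltW.
have acos_pi : acos (- k) < pi by apply: acos_ltpi; case/andP: k1 => ? ?; rewrite ltW ?andbT.
have aa : dot a a = 1.
  transitivity (g * g * dot u2 u2); last by rewrite g2 n2 mulr1.
  by rewrite /a /J /dot !coordE; ring.
have ab : dot a u2 = 0 by rewrite /a /J /dot !coordE; ring.
have u1a : dot u1 a = sin th.
  by rewrite sinth -gC /C /crs /a /J /dot !coordE; ring.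
have u1b : dot u1 u2 = - cos th by rewrite costh opprK.
have d1 : - g *: J u1 = cos th *: a + sin th *: u2.
  rewrite costh sinth -gC /k /a.
  have -> : - (g * C) *: u2 = g *: (- C *: u2) by rewrite scalerA; congr (_ *: _); ring.
  rewrite scalerA [- _ * g]mulrC -scalerA -scalerDr scaleNr -scalerN; congr (_ *: _).
  apply: planeP; rewrite /J /C /crs /dot !coordE.
    by move: n2; rewrite /dot => n2; rewrite -[LHS]mulr1 -n2; ring.
  by move: n2; rewrite /dot => n2; rewrite -[LHS]mulr1 -n2; ring.
have T12 : 0 < T1 < T2.
  by rewrite /T1 /T2 divr_gt0 //= ltr_pM2r ?invr_gt0.
exists x, a, u2, th, T1, T2; split; first by [].
have De2 : polar x a u2 T2 0 = e2.
  by rewrite /polar cos0 sin0 scale1r scale0r addr0 /x subrK.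
have De1 : polar x a u2 T1 th = e1 by rewrite /polar -d1 -xe1.
case/andP: T12 => T10 T12.
split; rewrite ?De1 ?De2 //.
  by apply/andP; split; rewrite /th; have := pi_gt0 R; lra.
move=> r t /andP[r1 r2] /andP[t0 t1] Dp.
set p := polar _ _ _ _ _ in Dp.
have dp : dsq p x = r ^+ 2 by exact: dsq_polar.
have pe2 : p != e2.
  apply/eqP => E; have := dsq_polar x T2 0 aa n2 ab.
  have : 0 < (T2 - r) * (T2 + r) by rewrite mulr_gt0 //; lra.
  by rewrite De2 -E dp => + F; rewrite -subr_sqr F subrr ltxx.
have pe1 : p != e1.
  apply/eqP => E; have := dsq_polar x T1 th aa n2 ab.
  have : 0 < (r - T1) * (r + T1) by rewrite mulr_gt0 //; lra.
  by rewrite De1 -E dp => + F; rewrite -subr_sqr F subrr ltxx.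
(* The support line at [e2] forces [t > pi]; the one at [e1] then forces [sin (th - t) < 0] although
   [th - t] lies in [[0, pi]]. *)
have s2 : sin t < 0.
  have := h2 p Dp pe2; have -> : dot u2 (p - e2) = r * sin t.
    by rewrite -De2 /p dot_polar dotC ab n2 cos0 sin0; ring.
  by rewrite pmulr_rlt0 //; lra.
have tpi : pi < t.
  rewrite ltNge; apply/negP => tp.
  by have := @sin_ge0_pi R t; rewrite t0 tp => /(_ isT); lra.
have := h1 p Dp pe1; have -> : dot u1 (p - e1) = r * sin (th - t).
  by rewrite -De1 /p dot_polar u1a u1b (sinB th t); move: (sin th) (cos th) => ? ?; ring.
rewrite pmulr_rlt0; last lra.
have h : 0 <= th - t <= pi by rewrite subr_ge0 t1 /= /th; lra.
by rewrite ltNge sin_ge0_pi.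
Qed.

Lemma tangent_gap (R : realType) (D : set (plane R)) :
  convex_disc D -> ~ circular_disc D ->
  exists x a b th T1 T2,
    [/\ dot a a = 1, dot b b = 1, dot a b = 0 & 0 < T1 < T2] /\
    [/\ 0 < th < pi *+ 2, D (polar x a b T2 0), D (polar x a b T1 th) &
        forall r t, T1 < r < T2 -> 0 <= t <= th -> ~ D (polar x a b r t)].
Proof.
move=> cD nD; apply: contrapT => H; apply: nD; apply: equal_tangents_circular => //.
move=> e1 u1 e2 u2 x1 x2 C0; apply: contrapT => H2; apply: H.
have [D1 n1 h1] := x1; have [D2 n2 h2] := x2.
have e12 : e1 != e2.
  by apply/eqP => E; apply: H2; rewrite E subrr /crs /px /py !mxE !mul0r subrr.
have A1 : 0 < dot u1 (e1 - e2).
  have := h1 e2 D2; rewrite eq_sym e12 => /(_ isT); rewrite /dot !coordE; lra.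
have A2 : 0 < dot u2 (e2 - e1).
  have := h2 e1 D1 e12; rewrite /dot !coordE; lra.
(* The two numbers are the tangent lengths times [|crs u1 u2|]. Unequal ones give the gap, with the
   roles of the two points chosen by size; equal ones give the parallelism through [lagrange]. *)
have [A|A|A] := ltgtP (dot u2 (e2 - e1)) (dot u1 (e1 - e2)).
- by apply: (unequal_tangents_gap x1 x2 C0); rewrite A2 A.
- by apply: (unequal_tangents_gap x2 x1); rewrite ?A1 ?A // crsC oppr_eq0.
exfalso; apply: H2; apply: (mulIf C0); rewrite mul0r lagrange.
have -> : dot (e1 - e2) u1 = dot u1 (e1 - e2) by rewrite /dot; ring.
have -> : dot (e1 - e2) u2 = - dot u2 (e2 - e1) by rewrite /dot !coordE; ring.
have -> : dot (u1 - u2) u2 = dot u1 u2 - dot u2 u2 by rewrite /dot !coordE; ring.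
have -> : dot (u1 - u2) u1 = dot u1 u1 - dot u1 u2 by rewrite /dot !coordE; ring.
by rewrite n1 n2 A; ring.
Qed.

(** * A chain of copies along a spiral *)

Lemma sin_le_id (R : realType) (t : R) : 0 <= t -> sin t <= t.
Proof.
rewrite le_eqVlt => /orP[/eqP <-|t0]; first by rewrite sin0.
have [c _] : exists2 c, c \in `]0, t[%R & sin t - sin 0 = cos c * (t - 0).
  apply: (@MVT R sin cos) => //.
  exact/continuous_subspaceT/continuous_sin.
by rewrite sin0 !subr0 => ->; rewrite ler_piMl ?cos_le1 ?(ltW t0).
Qed.

(** Bounds the total radial loss along the spiral. *)
Lemma bernoulli_lower (R : realType) (q : R) (n : nat) :
  0 <= q <= 1 -> 1 - n%:R * q <= (1 - q) ^+ n.
Proof.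
move=> /andP[q0 q1]; elim: n => [|n IH]; first by rewrite mul0r subr0.
have h : (1 - n%:R * q) * (1 - q) <= (1 - q) ^+ n * (1 - q).
  by rewrite ler_wpM2r // subr_ge0.
rewrite exprSr (le_trans _ h) // -natr1.
have : 0 <= n%:R * q * q :> R by rewrite !mulr_ge0.
lra.
Qed.

Lemma sin_triple (R : realType) (h : R) :
  sin (3 * h) = sin h * (3 - 4 * sin h ^+ 2).
Proof.
rewrite (_ : 3 * h = h + h + h); last by ring.
rewrite sinD cosD sinD; have := cos2Dsin2 h.
move: (sin h) (cos h) => s c e.
have e2 : c * c = 1 - s ^+ 2 by rewrite -expr2; lra.
have -> : (s * c + c * s) * c + (c * c - s * s) * s
  = 3 * s * (c * c) - s ^+ 3 by ring.
by rewrite e2; ring.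
Qed.

Lemma sin_ge_triple (R : realType) (h t : R) : 0 <= h ->
  3 * h <= t <= pi - 3 * h -> sin (3 * h) <= sin t.
Proof.
move=> h0 /andP[t1 t2].
have aux u : 3 * h <= u <= pi / 2 -> sin (3 * h) <= sin u.
  move=> /andP[u1 u2]; rewrite leNgt ltr_sin ?in_itv /= -?leNgt //; apply/andP; split=> //; lra.
have [tp|tp] := lerP t (pi / 2); first by apply: aux; rewrite t1.
have -> : sin t = sin (pi - t) by rewrite sinB sinpi cospi; ring.
by apply: aux; apply/andP; split; lra.
Qed.

Lemma cos_double_sin (R : realType) (t : R) : cos (2 * t) = 1 - 2 * sin t ^+ 2.
Proof.
rewrite (_ : 2 * t = t + t); last by ring.
by rewrite cosD -!expr2 cos2sin2; ring.
Qed.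

(* The square of |1 - rho z^(m+1)| > (1 + s/32) |1 - z| (1 + rho), z = e^(2ih).
   The constants 6 and 1/32 make the case m = 1 hold with margin
   19 s^2 + O(s^3). *)
Lemma chain_gap (R : realType) (h : R) (m : nat) :
  let s := sin h ^+ 2 in let rho := (1 - 6 * s) ^+ m in
  0 < h -> (0 < m)%N -> 0 < s <= 8^-1 -> 7 / 10 <= rho ->
  3 * h <= pi - m.+1%:R * h ->
  (1 + s / 32) ^+ 2 * (4 * s * (1 + rho) ^+ 2)
  < 1 + rho ^+ 2 - 2 * rho * cos (2 * (m.+1%:R * h)).
Proof.
move=> s rho h0 m0 /andP[s0 s8] rho7 hpi.
have rho1 : rho <= 1 by rewrite exprn_ile1 //; lra.
rewrite cos_double_sin.
case: m m0 @rho rho7 rho1 hpi => // [[|m]] _ rho rho7 rho1 hpi.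
  (* Neighbouring copies, [m = 1]: the difference becomes a polynomial in [s] divisible by
     [s ^+ 2]. *)
  have -> : sin (2%:R * h) ^+ 2 = 4 * s * (1 - s).
    rewrite (_ : 2%:R * h = h + h); last by ring.
    have -> : 1 - s = cos h ^+ 2 by rewrite /s cos2sin2.
    by rewrite sinD /s; ring.
  rewrite /rho expr1; move: (s) s0 s8 => {rho rho7 rho1 hpi}s s0 s8.
  rewrite -subr_gt0.
  have -> : 1 + (1 - 6 * s) ^+ 2 - 2 * (1 - 6 * s) * (1 - 2 * (4 * s * (1 - s)))
    - (1 + s / 32) ^+ 2 * (4 * s * (1 + (1 - 6 * s)) ^+ 2)
    = s * (s * (19 - s * (42 + 1 / 64 + s * (9 - 6 / 64 + s * (9 / 64))))) by field.
  have s2 : s * s <= 8^-1 * s by rewrite ler_pM2r.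
  have s3 : s * (s * s) <= s * 8^-1 by rewrite ler_pM2l //; lra.
  have s4 : s * (s * (s * 64^-1)) <= s * 64^-1.
    by rewrite ler_pM2l //; lra.
  do 2!apply: mulr_gt0 => //.
  have -> : 19 - s * (42 + 1 / 64 + s * (9 - 6 / 64 + s * (9 / 64)))
    = 19 - 42 * s - s * 64^-1 - 9 * (s * s) + 6 * (s * s) / 64
      - 9 * (s * (s * (s * 64^-1))) by field.
  lra.
(* For [m >= 2] crude bounds suffice: [4 * rho * S ^+ 2] is at least [17.5 * s] because
   [3 - 4 * s >= 5 / 2], while the other side stays below [16.7 * s]. *)
have m3 : 3 * h <= m.+3%:R * h by rewrite ler_pM2r // ler_nat.
have hs : sin (3 * h) <= sin (m.+3%:R * h).
  apply: sin_ge_triple; first by lra.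
  by move: hpi m3; lra.
set S := sin (m.+3%:R * h) in hs *.
have sh : 0 <= 3 - 4 * s by lra.
have h3 : s * (3 - 4 * s) ^+ 2 <= S ^+ 2.
  have -> : s * (3 - 4 * s) ^+ 2 = sin (3 * h) ^+ 2 by rewrite sin_triple exprMn.
  have h30 : 0 <= sin (3 * h) by rewrite sin_ge0_pi //; move: hpi m3; lra.
  by rewrite ler_sqr // nnegrE // (le_trans h30).
rewrite -subr_gt0.
have -> : 1 + rho ^+ 2 - 2 * rho * (1 - 2 * S ^+ 2)
  - (1 + s / 32) ^+ 2 * (4 * s * (1 + rho) ^+ 2)
  = (1 - rho) ^+ 2 + 4 * (rho * S ^+ 2) - (1 + s / 32) ^+ 2 * (4 * s * (1 + rho) ^+ 2).
  by ring.
have f1 : 5 / 2 * (5 / 2) <= (3 - 4 * s) ^+ 2 by rewrite expr2 ler_pM //; lra.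
have f2 : s * (5 / 2 * (5 / 2)) <= S ^+ 2 by apply: le_trans h3; rewrite ler_pM2l.
have f3 : 7 / 10 * (s * (5 / 2 * (5 / 2))) <= rho * S ^+ 2.
  by rewrite ler_pM //; lra.
have f4 : (1 + s / 32) ^+ 2 <= 51 / 50 * (51 / 50) by rewrite expr2 ler_pM //; lra.
have f5 : 4 * s * (1 + rho) ^+ 2 <= 4 * s * (2 * 2).
  by rewrite ler_wpM2l ?expr2 ?ler_pM //; lra.
have f6 : (1 + s / 32) ^+ 2 * (4 * s * (1 + rho) ^+ 2)
    <= 51 / 50 * (51 / 50) * (4 * s * (2 * 2)).
  by rewrite ler_pM // ?sqr_ge0 // mulr_ge0 ?sqr_ge0 //; lra.
have := sqr_ge0 (1 - rho); lra.
Qed.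

Lemma dsq_polar2 (R : realType) (x a b : plane R) (r t r' t' : R) :
  dot a a = 1 -> dot b b = 1 -> dot a b = 0 ->
  dsq (polar x a b r t) (polar x a b r' t')
  = r ^+ 2 + r' ^+ 2 - 2 * (r * r') * cos (t' - t).
Proof.
move=> aa bb ab; have c1 := cos2Dsin2 t; have c2 := cos2Dsin2 t'.
have -> : dsq (polar x a b r t) (polar x a b r' t')
  = (r * cos t - r' * cos t') ^+ 2 * dot a a
    + (r * sin t - r' * sin t') ^+ 2 * dot b b
    + 2 * (r * cos t - r' * cos t') * (r * sin t - r' * sin t') * dot a b.
  by rewrite /polar /dsq /dot !coordE; ring.
have -> : r ^+ 2 + r' ^+ 2 = r ^+ 2 * (cos t ^+ 2 + sin t ^+ 2)
    + r' ^+ 2 * (cos t' ^+ 2 + sin t' ^+ 2) by rewrite c1 c2 !mulr1.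
by rewrite aa bb ab cosB; ring.
Qed.

(** A chord almost as long as the diameter, with ends pulled into the interior because occlusion
    requires inner points. *)
Lemma large_chord (R : realType) (D : set (plane R)) (eps : R) :
  convex_disc D -> 0 < eps ->
  exists p q, [/\ D° p, D° q, p != q &
    forall y z, D y -> D z -> edist y z <= (1 + eps) * edist p q].
Proof.
move=> [cD convD [z0 oi]] e0.
have Do := interior_subset oi.
have [f Df hf] := farthest_point z0 cD (ex_intro _ z0 Do).
pose S := [set d | exists y z, [/\ D y, D z & d = edist y z]].
have supS : has_sup S.
  split; first by exists (edist z0 z0), z0, z0.
  exists (edist f z0 + edist f z0) => _ [y [z [Dy Dz ->]]].
  have le w : D w -> edist w z0 <= edist f z0 by move=> /hf h; rewrite !edistE ler_wsqrtr.
  by apply: (le_trans (edist_triangle z0 _ _)); rewrite lerD ?le // edistC le.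
have ub y z : D y -> D z -> edist y z <= sup S.
  by move=> Dy Dz; apply: sup_upper_bound => //; exists y, z.
have d0 : 0 < sup S.
  move/interior_edistP: oi => [r r0 hr].
  have Dv : D (z0 + vec (r / 2) 0).
    apply: hr; rewrite edist_lt ?ltW // /dsq !coordE.
    have := exprn_gt0 2 r0; lra.
  apply: (lt_le_trans _ (ub _ _ Do Dv)); apply: edist_gt0; apply/eqP.
  by move=> /(congr1 (@px R)); rewrite !coordE; lra.
(* Approximating the supremum and shrinking towards [z0] each cost a factor [1 - s]; this choice
   gives [(1 + eps) * (1 - s) ^+ 2 >= 1]. *)
pose s := eps / (2 * (1 + eps)).
have s1 : 2 * s * (1 + eps) = eps by rewrite /s; field; rewrite gt_eqF //; lra.
have s0 : 0 < s by rewrite divr_gt0 // mulr_gt0 //; lra.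
have s2 : s < 1 by nra.
have sd : 0 < s * sup S by rewrite mulr_gt0.
have [_ [y [z [Dy Dz ->]]] hyz] := sup_adherent sd supS.
pose p := y + s *: (z0 - y); pose q := z + s *: (z0 - z).
have s01 : 0 < s <= 1 by rewrite s0 ltW.
have pq : edist p q = (1 - s) * edist y z.
  rewrite !edistE; have -> : dsq p q = (1 - s) ^+ 2 * dsq y z.
    by rewrite /p /q /dsq !coordE; ring.
  by rewrite sqrtrM ?sqr_ge0 // sqrtr_sqr ger0_norm // subr_ge0 ltW.
have yz0 : 0 < edist y z by nra.
exists p, q; split.
- exact: interior_cone.
- exact: interior_cone.
- apply: contraTneq yz0 => E; move: pq; rewrite E edistE dsqxx sqrtr0 => /esym/eqP.
  by rewrite mulf_eq0 subr_eq0 [1 == _]gt_eqF //= => /eqP ->; rewrite ltxx.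
move=> u v Du Dv; apply: (le_trans (ub _ _ Du Dv)); rewrite pq.
have h1 : (1 - s) * (sup S - s * sup S) <= (1 - s) * edist y z.
  by rewrite ler_wpM2l ?(ltW hyz) // subr_ge0 ltW.
have h2 : (1 + eps) * ((1 - s) * (sup S - s * sup S)) <= (1 + eps) * ((1 - s) * edist y z).
  by rewrite ler_wpM2l //; lra.
apply: le_trans h2; rewrite -subr_ge0.
have -> : (1 + eps) * ((1 - s) * (sup S - s * sup S)) - sup S
  = sup S * (eps - 2 * s * (1 + eps) + s * s * (1 + eps)) by ring.
have e1 : 0 <= 1 + eps by lra.
rewrite s1 subrr add0r; move: (s) s0 (sup S) d0 => ? ? ? ?.
by rewrite !mulr_ge0 // ltW.
Qed.

(** The squared distance is continuous and positive on the compact product of radii, angles and [D],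
    so it has a positive minimum. *)
Lemma sector_distance (R : realType) (D : set (plane R)) (x a b : plane R)
    (t1 t2 th : R) :
  compact D -> D !=set0 -> t1 <= t2 -> 0 <= th ->
  (forall r t, t1 <= r <= t2 -> 0 <= t <= th -> ~ D (polar x a b r t)) ->
  exists2 eps, 0 < eps & forall r t y, t1 <= r <= t2 -> 0 <= t <= th -> D y ->
    eps <= edist y (polar x a b r t).
Proof.
move=> cD [y0 Dy0] t12 th0 hD.
pose K := (`[t1, t2] `*` `[0, th]) `*` D.
pose f (z : R * R * plane R) := dsq (polar x a b z.1.1 z.1.2) z.2.
have cK : compact K.
  by apply: compact_setX => //; apply: compact_setX; exact: segment_compact.
have K0 : K !=set0.
  by exists (t1, 0, y0); split=> //; split; rewrite /= in_itv /= lexx.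
have cr : continuous (fun z : R * R * plane R => z.1.1).
  by move=> z; apply: (@continuous_comp _ _ _ fst fst); exact: cvg_fst.
have ct : continuous (fun z : R * R * plane R => z.1.2).
  by move=> z; apply: (@continuous_comp _ _ _ fst snd);
    [exact: cvg_fst|exact: cvg_snd].
have cc : continuous (fun z : R * R * plane R => cos z.1.2).
  by move=> z; apply: (@continuous_comp _ _ _ (fun z : R * R * plane R => z.1.2) cos);
    [exact: ct|exact: continuous_cos].
have cs : continuous (fun z : R * R * plane R => sin z.1.2).
  by move=> z; apply: (@continuous_comp _ _ _ (fun z : R * R * plane R => z.1.2) sin);
    [exact: ct|exact: continuous_sin].
have cy j : continuous (fun z : R * R * plane R => z.2 ord0 j).
  move=> z; apply: (@continuous_comp _ _ _ snd (fun M : plane R => M ord0 j)).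
    exact: cvg_snd.
  exact: coord_continuous.
have cg j : continuous (fun z : R * R * plane R =>
    polar x a b z.1.1 z.1.2 ord0 j - z.2 ord0 j).
  have -> : (fun z : R * R * plane R => polar x a b z.1.1 z.1.2 ord0 j - z.2 ord0 j)
    = cst (x ord0 j) + (fun z : R * R * plane R => z.1.1) *
      ((fun z : R * R * plane R => cos z.1.2) * cst (a ord0 j)
       + (fun z : R * R * plane R => sin z.1.2) * cst (b ord0 j))
      - (fun z : R * R * plane R => z.2 ord0 j).
    by apply/funext => z; rewrite /polar !mxE.
  move=> z; apply: continuousB; last exact: cy.
  apply: continuousD; first exact: cst_continuous.
  apply: continuousM; first exact: cr.
  by apply: continuousD; apply: continuousM;
    [exact: cc|exact: cst_continuous|exact: cs|exact: cst_continuous].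
have cf : continuous f.
  have -> : f = (fun z : R * R * plane R => polar x a b z.1.1 z.1.2 ord0 ord0 - z.2 ord0 ord0)
    * (fun z : R * R * plane R => polar x a b z.1.1 z.1.2 ord0 ord0 - z.2 ord0 ord0)
    + (fun z : R * R * plane R => polar x a b z.1.1 z.1.2 ord0 ord_max - z.2 ord0 ord_max)
    * (fun z : R * R * plane R => polar x a b z.1.1 z.1.2 ord0 ord_max - z.2 ord0 ord_max).
    by apply/funext => z; rewrite /f /dsq !expr2.
  by move=> z; apply: continuousD; apply: continuousM; apply: cg.
have [[[r t] y] /set_mem [[/= hr ht] Dy] hmin] :=
  compact_EVT_min K0 cK (continuous_subspaceT cf).
move: hr ht; rewrite !in_itv /= => hr ht.
have f0 : 0 < f (r, t, y).
  apply: dsq_gt0 => /=; apply/eqP => E; apply: (hD r t hr ht).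
  by rewrite E.
exists (Num.sqrt (f (r, t, y))); first by rewrite sqrtr_gt0.
move=> r' t' y' hr' ht' Dy'; rewrite edistE dsqC ler_wsqrtr //.
by apply: (hmin (r', t', y')); apply: mem_set; split => //; split; rewrite /= in_itv.
Qed.

Lemma fine_step (R : realType) (th eta : R) : 0 < th -> 0 < eta ->
  exists2 n, (0 < n)%N & th / n%:R < eta.
Proof.
move=> th0 e0; have q0 : 0 <= th / eta by rewrite divr_ge0 ?ltW.
have hb := Num.Theory.archi_boundP q0.
exists (Num.bound (th / eta)); last first.
  have b0 : 0 < (Num.bound (th / eta))%:R :> R by apply: le_lt_trans hb.
  by rewrite ltr_pdivrMr // mulrC -ltr_pdivrMr.
by rewrite -(ltr_nat R); apply: le_lt_trans hb.
Qed.

(** [C k] carries the chord from [P k] to [Q k], and [P k.+1] lies on the segment from [x] to [Q k],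
    so each copy is occluded by the next. The last clause keeps the copies within [eta] of the
    sector. *)
Lemma spiral_chain (R : realType) (D : set (plane R)) (x a b : plane R)
    (th t1 t2 eta : R) :
  convex_disc D -> dot a a = 1 -> dot b b = 1 -> dot a b = 0 ->
  0 < th < pi *+ 2 -> 0 < t1 < t2 -> 0 < eta ->
  exists (n : nat) (C : nat -> set (plane R)) (P Q : nat -> plane R),
    [/\ forall k, similar_copy D (C k),
        forall k, (C k)° (P k) /\ (C k)° (Q k),
        P 0%N = polar x a b t2 0 /\
          exists2 r, t1 <= r & Q n = polar x a b r th,
        forall k, exists2 l, 0 < l <= 1 & P k.+1 = x + l *: (Q k - x) &
        (forall j k, (j < k <= n)%N -> C j `&` C k = set0) /\
        forall k w, (k <= n)%N -> C k w -> exists r t,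
          [/\ t1 <= r <= t2, 0 <= t <= th & edist w (polar x a b r t) < eta]].
Proof.
move=> cD aa bb ab /andP[th0 th2] /andP[t10 t12] eta0.
have t20 : 0 < t2 := lt_trans t10 t12.
have thn : th != 0 by rewrite gt_eqF.
have t2n : t2 != 0 by rewrite gt_eqF.
have pi0 := pi_gt0 R.
(* Bounds on the half step [h]: [e1] gives [s <= 1/8], [e2] gives [3 * h < pi - th / 2], [e3] and
   [e4] keep the radial loss below 3/10 and the radii at least [t1], and [e5] makes the copies
   smaller than [eta]. *)
pose e1 : R := 4^-1; pose e2 := (pi - th / 2) / 3; pose e3 := (10 * th)^-1.
pose e4 := (1 - t1 / t2) / (3 * th); pose e5 := eta / (4 * t2).
have e10 : 0 < e1 by rewrite invr_gt0.
have e20 : 0 < e2 by rewrite divr_gt0 //; lra.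
have e30 : 0 < e3 by rewrite invr_gt0 mulr_gt0.
have e40 : 0 < e4 by rewrite divr_gt0 ?mulr_gt0 // subr_gt0 ltr_pdivrMr // mul1r.
have e50 : 0 < e5 by rewrite divr_gt0 ?mulr_gt0.
pose e := Num.min e1 (Num.min e2 (Num.min e3 (Num.min e4 e5))).
have e0 : 0 < e by rewrite !lt_min e10 e20 e30 e40 e50.
have [[//|n] _ hn] := fine_step th0 e0.
have nn : n.+1%:R != 0 :> R by rewrite pnatr_eq0.
pose h := th / n.+1%:R / 2.
have nh : n.+1%:R * h = th / 2 by rewrite /h; field.
have h0 : 0 < h by rewrite !divr_gt0 // ltr0n.
have : h < e by rewrite (lt_trans _ hn) // /h gtr_pMr ?divr_gt0 ?ltr0n // invf_lt1 // ltr1n.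
rewrite !lt_min => /and5P[h1 h2 h3 h4 h5].
pose s := sin h ^+ 2; pose sg := 1 - 6 * s.
have sh0 : 0 < sin h.
  by apply: sin_gt0_pi; rewrite h0 /=; move: h2; rewrite /e2; lra.
have sh1 : sin h <= h by apply: sin_le_id; exact: ltW.
have s0 : 0 < s by rewrite exprn_gt0.
have sh : s <= h * h by rewrite /s expr2; apply: ler_pM => //; exact: ltW.
have hh : h * h <= h * 4^-1 by rewrite ler_pM2l //; exact: ltW h1.
have s8 : s <= 8^-1 by move: h1 hh sh; rewrite /e1; lra.
have sg0 : 0 < sg by rewrite /sg; lra.
have sg1 : sg <= 1 by rewrite /sg; lra.
have pow1 k : sg ^+ k <= 1 by rewrite exprn_ile1 // ltW.
have pow0 k : 0 < sg ^+ k by rewrite exprn_gt0.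
(* The total drop is first order in [h]: there are [n.+1] steps with [n.+1 * h = th / 2], each
   losing only [6 * s <= 6 * h ^+ 2]. *)
have ns : n.+1%:R * (6 * s) <= 3 * th * h.
  have : n.+1%:R * s <= n.+1%:R * (h * h) by rewrite ler_pM2l ?ltr0n.
  by rewrite [n.+1%:R * (h * h)]mulrA nh; lra.
have powlow k : (k <= n)%N -> 1 - 3 * th * h <= sg ^+ k.
  move=> kn; have q01 : 0 <= 6 * s <= 1 by apply/andP; split; lra.
  apply: le_trans (bernoulli_lower k q01).
  have : k%:R * (6 * s) <= n.+1%:R * (6 * s).
    by rewrite ler_wpM2r ?ler_nat ?(leqW kn) //; lra.
  by move: ns; lra.
have pow7 k : (k <= n)%N -> 7 / 10 <= sg ^+ k.
  move=> kn; apply: le_trans (powlow k kn).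
  have : th * h < th * e3 by rewrite ltr_pM2l.
  have -> : th * e3 = 10^-1 by rewrite /e3; field.
  lra.
have powt k : (k <= n)%N -> t1 <= t2 * sg ^+ k.
  move=> kn; rewrite -ler_pdivrMl //; apply: le_trans (powlow k kn).
  have : 3 * th * h < 3 * th * e4 by rewrite ltr_pM2l // mulr_gt0.
  have -> : 3 * th * e4 = 1 - t1 / t2 by rewrite /e4; field; rewrite ?t2n ?thn.
  by rewrite [t2^-1 * _]mulrC; lra.
pose r k := t2 * sg ^+ k.
have r0 k : 0 < r k by rewrite mulr_gt0.
(* Both ends of a chord have the same radius; the drop by [sg] occurs between [Q k] and [P k.+1], on
   a common ray. *)
pose P k := polar x a b (r k) (2 * (k%:R * h)).
pose Q k := polar x a b (r k) (2 * (k.+1%:R * h)).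
have dPQ k : dsq (Q k) (P k) = (2 * r k * sin h) ^+ 2.
  rewrite dsqC dsq_polar2 //.
  have -> : 2 * (k.+1%:R * h) - 2 * (k%:R * h) = 2 * h by rewrite -natr1; ring.
  by rewrite cos_double_sin; ring.
have ePQ k : edist (Q k) (P k) = 2 * r k * sin h.
  by rewrite edistE dPQ sqrtr_sqr ger0_norm // !mulr_ge0 // ltW.
have PQ k : P k != Q k.
  apply/eqP => E; have := ePQ k; rewrite E edistE dsqxx sqrtr0 => /esym F.
  by have := sh0; rewrite -(pmulr_rgt0 _ (_ : 0 < 2 * r k)) ?F ?ltxx // mulr_gt0.
pose eps := s / 32.
have ep0 : 0 < eps by rewrite divr_gt0.
have [p [q [ip iq pq hpq]]] := large_chord cD ep0.
pose C k := simmap p q (P k) (Q k) @` D.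
have epq : 0 < edist p q := edist_gt0 pq.
have scale k y z : D y -> D z ->
    edist (Q k) (P k) / edist q p * edist y z <= (1 + eps) * (2 * r k * sin h).
  move=> Dy Dz; rewrite ePQ (edistC q p) mulrAC ler_pdivrMr //.
  have -> : (1 + eps) * (2 * r k * sin h) * edist p q
    = 2 * r k * sin h * ((1 + eps) * edist p q) by ring.
  by rewrite ler_wpM2l ?hpq // -ePQ edist_ge0.
have nearP k w : C k w -> edist w (P k) <= (1 + eps) * (2 * r k * sin h).
  move=> [z Dz <-]; rewrite -{2}(simmap_fst p q (P k) (Q k)) edist_simmap //.
  by apply: scale => //; exact: interior_subset.
have nearQ k w : C k w -> edist w (Q k) <= (1 + eps) * (2 * r k * sin h).
  move=> [z Dz <-]; rewrite -{2}(simmap_snd (P k) (Q k) pq) edist_simmap //.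
  by apply: scale => //; exact: interior_subset.
exists n, C, P, Q; split.
- move=> k; exists (simmap p q (P k) (Q k)) => //; exact: similarity_simmap.
- move=> k; split.
    by have := interior_simmap pq (PQ k) ip; rewrite simmap_fst.
  by have := interior_simmap pq (PQ k) iq; rewrite simmap_snd.
- split; first by rewrite /P /r expr0 mulr1 mul0r mulr0.
  exists (r n); first exact: powt.
  by rewrite /Q nh; congr polar; field.
- move=> k; exists sg; first by rewrite sg0.
  by rewrite /P /Q /r /polar exprS; apply: planeP; rewrite !coordE; ring.
split.
  (* A common point [w] would bound the distance of the outer ends [P j] and [Q k] by the sum of two
     diameter bounds, contradicting [chain_gap] scaled by [r j]. *)
  move=> j k /andP[jk kn]; apply/seteqP; split => // w [/nearP wP /nearQ wQ].
  have [m m0 E] : exists2 m, (0 < m)%N & k = (j + m)%N.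
    by exists (k - j)%N; rewrite ?subn_gt0 // subnKC // ltnW.
  have mn : (m <= n)%N by apply: leq_trans kn; rewrite E leq_addl.
  have hm : 3 * h <= pi - m.+1%:R * h.
    have : m.+1%:R * h <= n.+1%:R * h by rewrite ler_pM2r // ler_nat.
    by rewrite nh; move: h2; rewrite /e2; lra.
  have s01 : 0 < s <= 8^-1 by rewrite s0.
  have gap := chain_gap h0 m0 s01 (pow7 m mn) hm.
  have rk : r k = r j * sg ^+ m by rewrite /r E exprD mulrA.
  have dPQjk : dsq (P j) (Q k)
      = r j ^+ 2 * (1 + (sg ^+ m) ^+ 2 - 2 * sg ^+ m * cos (2 * (m.+1%:R * h))).
    rewrite dsq_polar2 // rk.
    have -> : 2 * (k.+1%:R * h) - 2 * (j%:R * h) = 2 * (m.+1%:R * h).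
      by rewrite E -addnS natrD; ring.
    by ring.
  have tri : edist (P j) (Q k) <= (1 + eps) * (2 * r j * sin h) * (1 + sg ^+ m).
    apply: (le_trans (edist_triangle w _ _)); rewrite [edist (P j) w]edistC.
    by move: wP wQ; rewrite rk; lra.
  move: tri; rewrite edist_le; last first.
    by rewrite !mulr_ge0 ?addr_ge0 ?ltW // ltW.
  rewrite leNgt dPQjk.
  have -> : ((1 + eps) * (2 * r j * sin h) * (1 + sg ^+ m)) ^+ 2
      = r j ^+ 2 * ((1 + s / 32) ^+ 2 * (4 * s * (1 + sg ^+ m) ^+ 2)).
    by rewrite /eps /s; ring.
  by rewrite ltr_pM2l ?gap // exprn_gt0.
move=> k w kn /nearP wP; exists (r k), (2 * (k%:R * h)); split.
- by rewrite powt //= /r ler_piMr // ltW.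
- have kh : 0 <= k%:R * h by rewrite mulr_ge0 // ltW.
  have : k%:R * h <= n.+1%:R * h by rewrite ler_pM2r // ler_nat leqW.
  by rewrite nh => kh2; apply/andP; split; lra.
apply: (le_lt_trans wP).
have rt : r k <= t2 by rewrite /r ler_piMr // ltW.
have rs : r k * sin h <= t2 * h by rewrite ler_pM // ltW.
have h5' : h * (4 * t2) < eta by rewrite -ltr_pdivlMr ?mulr_gt0.
have : eps * (r k * sin h) <= 1 * (r k * sin h).
  by rewrite ler_wpM2r ?mulr_ge0 ?ltW // /eps; lra.
lra.
Qed.

(** * Cyclic occlusion *)

Definition occludes (R : realType) (x : plane R) (C C' : set (plane R)) : Prop :=
  exists y l, [/\ 0 < l <= 1, C'° y & C° (x + l *: (y - x))].

Lemma interior_homothety (R : realType) (A : set (plane R)) (x y : plane R) (l : R) :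
  0 < l -> A° (x + l *: (y - x)) -> [set z | A° (x + l *: (z - x))]° y.
Proof.
move=> l0 /nbhs_interior/interior_edistP[r r0 hr]; apply/interior_edistP.
exists (r / l); first by rewrite divr_gt0.
move=> w; rewrite edist_lt ?divr_ge0 ?ltW // => hw; apply: hr.
rewrite edist_lt ?ltW //.
have -> : dsq (x + l *: (w - x)) (x + l *: (y - x)) = l ^+ 2 * dsq w y.
  by rewrite /dsq !coordE; ring.
by rewrite -ltr_pdivlMl ?exprn_gt0 // mulrC -expr_div_n.
Qed.

(** Replaces a contact point, known only to belong to [D], by a nearby inner point without leaving
    the neighbourhood [A]. *)
Lemma convex_interior_dense (R : realType) (D A : set (plane R)) (e : plane R) :
  @convex_set R (plane R) D -> D° !=set0 -> D e -> A° e ->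
  exists2 y, D° y & A y.
Proof.
move=> cD [z iz] De /interior_edistP[r r0 hr].
have d0 := edist_ge0 z e.
(* Moving from [e] towards [z] by the fraction [s / 2] covers a distance less than [r]. *)
pose s := r / (r + edist z e).
have rd : 0 < r + edist z e by rewrite ltr_pwDl.
have s0 : 0 < s by rewrite divr_gt0.
have s1 : s <= 1 by rewrite ler_pdivrMr // mul1r lerDl.
have s2 : 0 < s / 2 <= 1 by rewrite divr_gt0 //=; lra.
exists (e + (s / 2) *: (z - e)); first exact: interior_cone.
apply: hr; rewrite edistE.
have -> : dsq (e + (s / 2) *: (z - e)) e = (s / 2) ^+ 2 * dsq z e.
  by rewrite /dsq !coordE; ring.
rewrite sqrtrM ?sqr_ge0 // sqrtr_sqr -edistE ger0_norm; last by rewrite divr_ge0 // ltW.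
have sr : s * (r + edist z e) = r by rewrite /s mulfVK // gt_eqF.
have sr0 : 0 < s * r by rewrite mulr_gt0.
have : 0 <= s * edist z e by rewrite mulr_ge0 // ltW.
move: sr; rewrite mulrDr; lra.
Qed.

Lemma cyclic_occlusion_not_separable (R : realType) (F : set (set (plane R)))
    (x : plane R) :
  (forall C', F C' -> exists C, [/\ F C, C != C' & occludes x C C']) ->
  ~ exists T, separating_polygonal_tiling F T.
Proof.
move=> hF [T [[covT trivT] convT cellT discT]].
have : cover T id x by rewrite covT.
move=> [P TP /= Px]; have [C' [[FC' C'P] uniqP]] := cellT P TP.
have [C [FC CC' [y [l [l01 yC' lC]]]]] := hF C' FC'.
have [P' TP' CP'] := discT C FC.
have [_ convP _ _] := convT P TP.
(* The point on the segment is interior to the cell [P] of [x], by convexity, and to the cell [P']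
   of [C]. So the cells coincide, and [P] contains two discs. *)
have PP' : P = P'.
  apply: trivT => //; exists (x + l *: (y - x)); split.
    by apply: interior_cone => //; exact: (interiorS C'P).
  exact: (interiorS CP').
move/eqP: CC'; apply; apply/esym/uniqP; split=> //.
by rewrite PP'.
Qed.

(* Without F !=set0 the empty family would be a trivial witness: it admits no
   tiling in which every cell contains exactly one of its members. *)
Theorem theorem5 (R : realType) (D : set (plane R)) :
  convex_disc D -> ~ circular_disc D ->
  exists F : set (set (plane R)),
    [/\ finite_set F, F !=set0,
        (forall C, F C -> similar_copy D C),
        trivIset F id &
        ~ exists T : set (set (plane R)), separating_polygonal_tiling F T].
Proof.
move=> discD nD; have [cD convD D0] := discD.
have [z iz] := D0; have Dz := interior_subset iz.
have [x [a [b [th [T1 [T2 [[aa bb ab /andP[T10 T12]] [th02 De2 De1 gap]]]]]]]] :=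
  tangent_gap discD nD.
have [th0 th2] := andP th02.
(* Trisecting the interval of radii leaves a closed sector that misses [D], as the compactness
   argument requires. *)
pose t1 := (2 * T1 + T2) / 3; pose t2 := (T1 + 2 * T2) / 3.
have [h1 h2 h3] : [/\ T1 < t1, t1 < t2 & t2 < T2] by rewrite /t1 /t2; split; lra.
have gap' r t : t1 <= r <= t2 -> 0 <= t <= th -> ~ D (polar x a b r t).
  by move=> /andP[r1 r2]; apply: gap; apply/andP; split; lra.
have [eps eps0 heps] :=
  sector_distance cD (ex_intro _ z Dz) (ltW h2) (ltW th0) gap'.
have t12 : 0 < t1 < t2 by rewrite h2 andbT; lra.
have [n [C [P [Q [simC iPQ [P0 [r tr Qn]] step [disj nearC]]]]]] :=
  spiral_chain x discD aa bb ab th02 t12 eps0.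
have DC k : (k <= n)%N -> D `&` C k = set0.
  move=> kn; apply/seteqP; split => // w [Dw Cw].
  have [r' [t [hr ht]]] := nearC k w kn Cw.
  by rewrite ltNge heps.
have neC k : (C k) (P k) by apply: interior_subset; exact: (iPQ k).1.
have neqC A B : A `&` B = set0 -> A !=set0 -> A != B :> set (plane R).
  by move=> AB [w Aw]; apply/eqP => E; rewrite E setIid -E in AB; rewrite AB in Aw.
exists (D |` [set C k | k in `I_n.+1]); split.
- by rewrite finite_setU; split; [exact: finite_set1|apply: finite_image].
- by exists D; left.
- move=> _ [->|[k _ <-]] //; exists id; last by rewrite image_id.
  by exists 1 => // y w; rewrite mul1r.
- move=> A B /= [->|[j jn <-]] [->|[k kn <-]] [w [Aw Bw]] //.
  + by have : set0 w by rewrite -(DC k kn).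
  + by have : set0 w by rewrite -(DC j jn).
  have [jk|jk|-> //] := ltngtP j k.
    by have : set0 w by rewrite -(disj j k) // jk.
  by have : set0 w by rewrite -(disj k j) // jk.
apply: (@cyclic_occlusion_not_separable _ _ x) => A [->|[k kn <-]].
  (* [C 0] stands in front of the far contact point: [P 0] lies on the same ray, at radius
     [t2 < T2]. *)
  exists (C 0%N); split; first by right; exists 0%N.
    by rewrite eq_sym; apply: neqC; [exact: DC|exists z].
  have T20 : 0 < T2 by lra.
  have l01 : 0 < t2 / T2 <= 1.
    by rewrite divr_gt0 ?ler_pdivrMr ?mul1r //=; lra.
  have [l0 _] := andP l01.
  have E : P 0%N = x + (t2 / T2) *: (polar x a b T2 0 - x).
    by rewrite P0; apply: planeP; rewrite /polar !coordE; field; rewrite gt_eqF.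
  have := (iPQ 0%N).1; rewrite E => /(interior_homothety l0) i0.
  have [y iy Cy] := convex_interior_dense convD D0 De2 i0.
  by exists y, (t2 / T2).
have [kn'|kn'] := ltnP k n.
  exists (C k.+1); split; first by right; exists k.+1.
    by rewrite eq_sym; apply: neqC; [apply: disj; rewrite ltnSn|exists (P k)].
  have [l l01 Pk] := step k.
  by exists (Q k), l; split=> //; [exact: (iPQ k).2|rewrite -Pk; exact: (iPQ k.+1).1].
have {kn kn'}-> : k = n by apply/eqP; rewrite eqn_leq kn' andbT -ltnS.
(* The cycle closes: [Q n] lies on the ray of the near contact point at radius [r > T1], so [D]
   occludes the last copy. *)
exists D; split; first by left.
  by apply: neqC; [exact: DC|exists z].
have r0 : 0 < r by lra.
have l01 : 0 < T1 / r <= 1 by rewrite divr_gt0 ?ler_pdivrMr ?mul1r //=; lra.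
have li0 : 0 < (T1 / r)^-1 by rewrite invr_gt0; case/andP: l01.
have E : Q n = x + (T1 / r)^-1 *: (polar x a b T1 th - x).
  rewrite Qn; apply: planeP; rewrite /polar !coordE; field;
    by rewrite !gt_eqF.
have := (iPQ n).2; rewrite E => /(interior_homothety li0) i1.
have [y iy Cy] := convex_interior_dense convD D0 De1 i1.
(* The occluded point is [y] pushed outwards by [r / T1], which lands inside [C n] near [Q n];
   scaling back recovers the inner point [y] of [D]. *)
exists (x + (T1 / r)^-1 *: (y - x)), (T1 / r); split=> //.
rewrite [X in D° X](_ : _ = y) //.
by apply: planeP; rewrite !coordE; field; rewrite !gt_eqF.
Qed.
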